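(* Let $\mathbf{X}_1,\dots,\mathbf{X}_n\in\mathbb{R}^d$ and suppose the loss $\rho$ satisfies: (A1) $\rho$ is non-decreasing, $\rho(0)=0$, and $\rho(x)/x\to 0$ as $x\to 0$; (A2) $\varphi(0)\triangleq\lim_{x\to 0}\psi(x)/x$ exists and is finite. Suppose moreover that $J(g)=\frac1n\sum_{i=1}^n\rho(\|\Phi(\mathbf{X}_i)-g\|_{\mathcal{H}})$ is strictly convex on $\mathcal{H}$. If $f\in\mathcal{H}$ is of the form $$f(\mathbf{x})=\sum_{i=1}^n w_i\,k_\sigma(\mathbf{x},\mathbf{X}_i)\quad(\mathbf{x}\in\mathbb{R}^d),$$ with $\sum_{i=1}^n w_i=1$ and $w_i\propto\varphi(\|\Phi(\mathbf{X}_i)-f\|_{\mathcal{H}})$ (proportionality constant independent of $i$), then $f$ is the minimizer of $J$ over $\mathcal{H}$, i.e. $f=\widehat{f}_{RKDE}$.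
   Context: The kernel $k_\sigma:\mathbb{R}^d\times\mathbb{R}^d\to[0,\infty)$ satisfies $\int k_\sigma(\mathbf{x},\cdot)\,d\mathbf{x}=1$, is radial, meaning $k_\sigma(\mathbf{x},\mathbf{x}')=g_0(\|\mathbf{x}-\mathbf{x}'\|^2)$ for some function $g_0$, and is positive semi-definite. $\mathcal{H}$ is the reproducing kernel Hilbert space (real) associated with $k_\sigma$, and $\Phi(\mathbf{x})\triangleq k_\sigma(\cdot,\mathbf{x})\in\mathcal{H}$ is the canonical feature map, so $g(\mathbf{x})=\langle\Phi(\mathbf{x}),g\rangle_{\mathcal{H}}$ for $g\in\mathcal{H}$. The loss $\rho:[0,\infty)\to\mathbb{R}$ is differentiable, $\psi\triangleq\rho'$, and $\varphi(x)\triangleq\psi(x)/x$ for $x>0$. The robust kernel density estimate is $\widehat{f}_{RKDE}=\arg\min_{g\in\mathcal{H}}J(g)$. *)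

(* Defs.v *)
From HB Require Import structures.
From mathcomp Require Import all_boot all_order all_algebra.
From mathcomp Require Import all_classical all_reals all_analysis.

Set Implicit Arguments.
Unset Strict Implicit.
Unset Printing Implicit Defensive.

Import Order.TTheory GRing.Theory Num.Theory.
Import numFieldNormedType.Exports.

Local Open Scope classical_set_scope.
Local Open Scope ring_scope.

Section LebesgueTuple.
Variable R : realType.
Local Notation U := (measurableTypeR R).
Local Open Scope ereal_scope.

Definition cons_pair n (p : U * n.-tuple U) : n.+1.-tuple U :=
  [the n.+1.-tuple U of p.1 :: p.2].

(* Lebesgue measure on R^n, carried by the library's measurable space of
   n-tuples (product sigma-algebra): n-fold product of the measure on R. *)
Fixpoint lebesgue_measure_tuple (n : nat) : set (n.-tuple U) -> \bar R :=
  match n with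
  | 0 => \d_([tuple] : 0.-tuple U)
  | m.+1 =>
    pushforward (@lebesgue_measure R \x @lebesgue_measure_tuple m)
      (@cons_pair m)
  end.

Section step.
Variables (n : nat) (mu : {sigma_finite_measure set (n.-tuple U) -> \bar R}).

Let nu := pushforward (@lebesgue_measure R \x mu) (@cons_pair n).

Let mcons : measurable_fun [set: U * n.-tuple U] (@cons_pair n).
Proof. exact: (measurable_cons measurable_fst measurable_snd). Qed.

Let nu0 : nu set0 = 0.
Proof. by rewrite /nu /pushforward preimage_set0 measure0. Qed.

Let nu_ge0 A : 0 <= nu A. Proof. exact: measure_ge0. Qed.

Let nu_sigma_additive : semi_sigma_additive nu.
Proof.
exact: measure_semi_sigma_additive.
Qed.

HB.instance Definition _ := isMeasure.Build _ _ _ nu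
  nu0 nu_ge0 nu_sigma_additive.

Let nu_sigma_finite : sigma_finite setT nu.
Proof.
pose g (t : n.+1.-tuple U) : U * n.-tuple U := (thead t, [tuple of behead t]).
have mg : measurable_fun [set: n.+1.-tuple U] g.
  by apply: measurable_fun_pair; [exact: measurable_tnth|exact: measurable_behead].
have gK : cancel (@cons_pair n) g.
  by case=> x t; congr pair; apply: val_inj.
have /sigma_finiteP[F [TF ndF Foo]] := sigma_finiteT (@lebesgue_measure R).
have /sigma_finiteP[G [TG ndG Goo]] := sigma_finiteT mu.
exists (fun i => g @^-1` (F i `*` G i)).
  apply/seteqP; split => // t _.
  have : [set: U] (g t).1 by []. rewrite TF => -[i _ Fi].
  have : [set: n.-tuple U] (g t).2 by []. rewrite TG => -[j _ Gj].
  exists (maxn i j) => //; split.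
  - by move: Fi; exact/subsetPset/ndF/leq_maxl.
  - by move: Gj; exact/subsetPset/ndG/leq_maxr.
move=> i; have [mF Foo'] := Foo i; have [mG Goo'] := Goo i; split.
  by rewrite -[X in measurable X]setTI; apply: mg => //; exact: measurableX.
rewrite /nu /pushforward -comp_preimage.
rewrite (_ : g \o _ = id); last by apply/funext => p /=; rewrite gK.
by rewrite preimage_id product_measure1E// lte_mul_pinfty// ge0_fin_numE.
Qed.

HB.instance Definition _ :=
  Measure_isSigmaFinite.Build _ _ _ nu nu_sigma_finite.

Lemma lebesgue_measure_tuple_step :
  exists nu' : {sigma_finite_measure set (n.+1.-tuple U) -> \bar R},
    nu' = nu :> (set _ -> \bar R).
Proof. by exists nu. Qed.

End step.

Lemma lebesgue_measure_tupleP n :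
  exists mu : {sigma_finite_measure set (n.-tuple U) -> \bar R},
    mu = @lebesgue_measure_tuple n :> (set _ -> \bar R).
Proof.
elim: n => [|n [mu muE]]; first by exists \d_([tuple] : 0.-tuple U).
have [nu nuE] := lebesgue_measure_tuple_step mu.
by exists nu; rewrite nuE muE.
Qed.

Section instances.
Variable n : nat.
Local Notation leb := (@lebesgue_measure_tuple n).

Let leb0 : leb set0 = 0.
Proof. by have [mu <-] := lebesgue_measure_tupleP n; exact: measure0. Qed.

Let leb_ge0 A : 0 <= leb A.
Proof. by have [mu <-] := lebesgue_measure_tupleP n; exact: measure_ge0. Qed.

Let leb_sigma_additive : semi_sigma_additive leb.
Proof.
have [mu <-] := lebesgue_measure_tupleP n.
exact: measure_semi_sigma_additive.
Qed.

HB.instance Definition _ := isMeasure.Build _ _ _ leb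
  leb0 leb_ge0 leb_sigma_additive.

Let leb_sigma_finite : sigma_finite setT leb.
Proof. by have [mu <-] := lebesgue_measure_tupleP n; exact: sigma_finiteT. Qed.

HB.instance Definition _ :=
  Measure_isSigmaFinite.Build _ _ _ leb leb_sigma_finite.

End instances.
End LebesgueTuple.
Arguments lebesgue_measure_tuple : clear implicits.

Section Kernel.
Variable R : realType.

(* The library norm on 'rV is the sup norm. *)
Definition euclidean_norm d (x : 'rV[R]_d) : R :=
  Num.sqrt (\sum_(i < d) x 0 i ^+ 2).

(* The library has a measurable structure on tuples but not on 'rV, so integrals
   over R^d are taken over tuples. *)
Definition row_of_tuple d (t : d.-tuple (measurableTypeR R)) : 'rV[R]_d :=
  \row_i tnth t i.

Definition integrates_to_one d (k : 'rV[R]_d -> 'rV[R]_d -> R) : Prop :=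
  forall x',
    measurable_fun [set: d.-tuple (measurableTypeR R)]
      (fun t => k (row_of_tuple t) x') /\
    (\int[lebesgue_measure_tuple R d]_t (k (row_of_tuple t) x')%:E = 1)%E.

Definition radial d (k : 'rV[R]_d -> 'rV[R]_d -> R) : Prop :=
  exists g0 : R -> R, forall x x', k x x' = g0 (euclidean_norm (x - x') ^+ 2).

(* Symmetry of k is not required here; a radial kernel is symmetric. *)
Definition positive_semidefinite (T : Type) (k : T -> T -> R) : Prop :=
  forall (m : nat) (x : 'I_m -> T) (c : 'I_m -> R),
    0 <= \sum_(i < m) \sum_(j < m) c i * c j * k (x i) (x j).

Definition smoothing_kernel d (k : 'rV[R]_d -> 'rV[R]_d -> R) : Prop :=
  [/\ forall x x', 0 <= k x x', integrates_to_one k, radial k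
    & positive_semidefinite k].

End Kernel.

(* A real Hilbert space of functions on T (its elements are identified with
   functions through the injective linear map rkhs_eval) that contains the
   sections k(., x) and in which they reproduce point evaluation. *)
Record rkhs (R : realType) (T : Type) (k : T -> T -> R) := Rkhs {
  rkhs_space :> completeNormedModType R;
  rkhs_dot : {dot rkhs_space for idfun};
  rkhs_normE : forall g : rkhs_space, `|g| = Num.sqrt (rkhs_dot g g);
  rkhs_eval : {linear rkhs_space -> (T -> R^o)};
  rkhs_eval_inj : injective rkhs_eval;
  rkhs_feature : T -> rkhs_space;
  rkhs_featureE : forall x y, rkhs_eval (rkhs_feature x) y = k y x;
  rkhs_reproducing : forall (g : rkhs_space) x,
    rkhs_eval g x = rkhs_dot (rkhs_feature x) g
}.

Section Loss.
Variable R : realType.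
Implicit Type rho : R -> R.

(* A function on [0, +oo[ is represented by rho : R -> R; only its values on
   [0, +oo[ are used, whence the one-sided limits at 0. *)
Definition differentiable_nonneg rho : Prop :=
  (forall x, 0 < x -> derivable rho x 1) /\
  cvg ((rho h - rho 0) / h @[h --> 0^'+]).

Definition loss_psi rho (x : R) : R :=
  if 0 < x then derive1 rho x else lim ((rho h - rho 0) / h @[h --> 0^'+]).

Definition loss_phi rho (x : R) : R :=
  if 0 < x then loss_psi rho x / x
  else lim (loss_psi rho h / h @[h --> 0^'+]).

Definition loss_A1 rho : Prop :=
  [/\ forall x y, 0 <= x -> x <= y -> rho x <= rho y,
      rho 0 = 0
    & rho x / x @[x --> 0^'+] --> (0 : R)].

Definition loss_A2 rho : Prop := cvg (loss_psi rho x / x @[x --> 0^'+]).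

End Loss.

Section RKDE.
Variable R : realType.

Definition strictly_convex (E : lmodType R) (J : E -> R) : Prop :=
  forall (g h : E) (t : R), g != h -> 0 < t -> t < 1 ->
    J (t *: g + (1 - t) *: h) < t * J g + (1 - t) * J h.

Definition rkde_objective (T : Type) (k : T -> T -> R) (H : rkhs k)
    (rho : R -> R) (n : nat) (X : 'I_n -> T) (g : H) : R :=
  n%:R^-1 * \sum_(i < n) rho `|rkhs_feature H (X i) - g|.

(* f is the minimizer: it attains the minimum and is the only point doing so. *)
Definition is_argmin (E : Type) (J : E -> R) (f : E) : Prop :=
  (forall g, J f <= J g) /\ (forall g, (forall h, J g <= J h) -> g = f).

Definition is_rkde (T : Type) (k : T -> T -> R) (H : rkhs k)
    (rho : R -> R) (n : nat) (X : 'I_n -> T) (f : H) : Prop :=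
  is_argmin (rkde_objective rho X) f.

End RKDE.
Arguments rkde_objective {R T k} H rho {n} X g.
Arguments is_rkde {R T k} H rho {n} X f.

(* Main.v *)
(* The condition on the weights says that f is a stationary point: since
   f = sum_i w_i Phi(X_i) and sum_i w_i = 1, the vectors Phi(X_i) - f have
   w-weighted sum 0, and w is a nonzero multiple of the vector of phi-values.
   That phi-weighted sum, paired with h, is -n times the one-sided derivative of
   J at f in the direction h; a term with Phi(X_i) = f, where the norm is not
   differentiable, has slope 0 because rho(x) = o(x).  For convex J the slope
   (J(f + t(g - f)) - J f)/t is at most J g - J f for 0 < t < 1, so a vanishing
   derivative at f gives J f <= J g. *)
Require Import Defs.
From HB Require Import structures.
From mathcomp Require Import all_boot all_order all_algebra.
From mathcomp Require Import all_classical all_reals all_analysis.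
From mathcomp Require Import ring lra.
Import Order.TTheory GRing.Theory Num.Theory.
Import numFieldNormedType.Exports.
Local Open Scope classical_set_scope.
Local Open Scope ring_scope.

Lemma is_derive_right_slope (R : realType) (F : R -> R) (x l : R) :
  is_derive x 1 F l -> (F (x + t) - F x) / t @[t --> 0^'+] --> l.
Proof.
move=> [dF <-]; apply: cvg_dnbhs_at_right.
move: dF; rewrite /derivable /derive => dF.
rewrite [X in X @ _](_ : _ =
  fun h : R => h^-1 *: ((F \o shift x) (h *: 1) - F x))//.
apply/funext => h /=.
by rewrite /GRing.scale /= mulr1 mulrC (addrC h).
Qed.

Section DirectionalDerivative.
Variables (R : realType) (U : normedModType R) (dot : {dot U for idfun}).
Hypothesis normE : forall u : U, `|u| = Num.sqrt (dot u u).

Lemma dot_expand (a h : U) (t : R) :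
  dot (a - t *: h) (a - t *: h) =
  dot a a - 2 * t * dot a h + t ^+ 2 * dot h h.
Proof.
have dotC : dot h a = dot a h by rewrite (hermC dot) expr0 mul1r.
rewrite linearBl !linearBr !linearZl_LR !linearZr_LR /= dotC.
rewrite /GRing.scale /=; ring.
Qed.

(** The squared norm along the line is a quadratic polynomial in [t], positive at [t = 0] because
    [a != 0], so the chain rule applies to its square root. *)
Lemma is_derive_norm_line (a h : U) : a != 0 ->
  is_derive (0 : R) 1 (fun t : R => `|a - t *: h|) (- (dot a h / `|a|)).
Proof.
move=> a0.
have na0 : 0 < `|a| by rewrite normr_gt0.
have aa0 : 0 < dot a a by move: na0; rewrite normE sqrtr_gt0.
pose q (t : R) : R := dot a a - 2 * t * dot a h + t ^+ 2 * dot h h.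
have -> : (fun t : R => `|a - t *: h|) = Num.sqrt \o q.
  by apply/funext => t /=; rewrite normE dot_expand.
have dq : is_derive (0 : R) 1 q (- (2 * dot a h)).
  rewrite /q; apply: is_derive_eq.
  rewrite /GRing.scale /=; ring.
have q0 : q 0 = dot a a by rewrite /q; ring.
have ds : is_derive (q 0) 1 Num.sqrt (2 * `|a|)^-1.
  by rewrite q0 normE; exact: is_derive1_sqrt.
rewrite (_ : - _ = (2 * `|a|)^-1 * - (2 * dot a h)).
  exact: is_derive1_comp.
by field; rewrite gt_eqF.
Qed.

Lemma loss_norm_slope (rho : R -> R) (a h : U) :
  (forall x, 0 < x -> derivable rho x 1) -> rho 0 = 0 ->
  rho x / x @[x --> 0^'+] --> (0 : R) ->
  (rho `|a - t *: h| - rho `|a|) / t @[t --> 0^'+] -->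
    - (loss_phi rho `|a| * dot a h).
Proof.
move=> drho rho0 rhoo.
have [->|a0] := eqVneq a 0.
  rewrite linear0l mulr0 oppr0 normr0 rho0.
  have [->|h0] := eqVneq h 0.
    apply: cvg_near_cst; near=> t.
    by rewrite scaler0 !subr0 normr0 rho0 mul0r.
  have nh0 : 0 < `|h| by rewrite normr_gt0.
  (* With [a = 0] the quotient is that of [rho] along [x = t * |h|]. Since [|h| > 0], this [x] tends
     to 0 through positive values, so the limit of [rho x / x] can be composed with it. *)
  have small : (t * `|h|) @[t --> (0 : R)^'+] --> 0^'+.
    move=> A [e /= e0 eA]; suff : \forall t \near 0^'+, A (t * `|h|) by [].
    near=> t.
    have t0 : 0 < t by near: t; exact: nbhs_right_gt.
    apply: eA; last by rewrite mulr_gt0.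
    rewrite /= sub0r normrN ger0_norm ?mulr_ge0 ?ltW// -ltr_pdivlMr//.
    by near: t; apply: nbhs_right_lt; rewrite divr_gt0.
  have lim0 : rho (t * `|h|) / (t * `|h|) * `|h| @[t --> 0^'+] --> (0 : R).
    rewrite -[X in _ --> X](mul0r `|h|).
    by apply: cvgM; [exact: cvg_comp small rhoo|exact: cvg_cst].
  apply: cvg_trans lim0; apply: near_eq_cvg; near=> t.
  have t0 : 0 < t by near: t; exact: nbhs_right_gt.
  rewrite /= sub0r normrN subr0 normrZ gtr0_norm//; field.
  by rewrite !gt_eqF.
have na0 : 0 < `|a| by rewrite normr_gt0.
pose N (t : R) := `|a - t *: h|.
have N0 : N 0 = `|a| by rewrite /N scale0r subr0.
have dr : is_derive (N 0) 1 rho (derive1 rho `|a|).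
  by rewrite N0 derive1E; apply: derivableP; exact: drho.
have := is_derive_right_slope _ _ _ _ (is_derive1_comp dr (is_derive_norm_line _ h a0)).
rewrite /loss_phi /loss_psi na0 /= N0.
(* The factor [1 / |a|] from the derivative of the norm is what turns psi into phi. *)
have -> : - (derive1 rho `|a| / `|a| * dot a h) = derive1 rho `|a| * - (dot a h / `|a|) by ring.
by under eq_fun do rewrite add0r.
Unshelve. all: by end_near.
Qed.

End DirectionalDerivative.

Section Objective.
Variables (R : realType) (T : Type) (k : T -> T -> R) (H : rkhs k).
Variables (rho : R -> R) (n : nat) (X : 'I_n -> T).
Local Notation Phi := (rkhs_feature H).

(** Lifts the pointwise expansion to the Hilbert space through the injectivity of evaluation. *)
Lemma feature_combination (f : H) (w : 'I_n -> R) :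
  (forall x, rkhs_eval H f x = \sum_(i < n) w i * k x (X i)) ->
  f = \sum_(i < n) w i *: Phi (X i).
Proof.
move=> hf; apply: (@rkhs_eval_inj _ _ _ H); apply/funext => x.
rewrite hf linear_sum fct_sumE /=; apply: eq_bigr => i _.
by rewrite linearZ /= /GRing.scale /= rkhs_featureE.
Qed.

Lemma stationary_point (f : H) (w : 'I_n -> R) (c : R) :
  f = \sum_(i < n) w i *: Phi (X i) -> \sum_(i < n) w i = 1 ->
  (forall i, w i = c * loss_phi rho `|Phi (X i) - f|) ->
  \sum_(i < n) loss_phi rho `|Phi (X i) - f| *: (Phi (X i) - f) = 0.
Proof.
move=> hf hw1 hw.
(* If [c = 0], all weights vanish and cannot sum to 1. *)
have c0 : c != 0.
  apply: contra_eq_neq hw1 => c0; rewrite big1 1?eq_sym ?oner_neq0// => i _.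
  by rewrite hw c0 mul0r.
(* After multiplication by [c] the coefficients become the weights, and the sum is [f - 1 *: f]. *)
apply: (scalerI c0); rewrite scaler0 scaler_sumr.
under eq_bigr do rewrite scalerA -hw scalerBr.
by rewrite sumrB -hf -scaler_suml hw1 scale1r subrr.
Qed.

Lemma objective_slope_at_stationary (f h : H) :
  (forall x, 0 < x -> derivable rho x 1) -> rho 0 = 0 ->
  rho x / x @[x --> 0^'+] --> (0 : R) ->
  \sum_(i < n) loss_phi rho `|Phi (X i) - f| *: (Phi (X i) - f) = 0 ->
  (rkde_objective H rho X (f + t *: h) - rkde_objective H rho X f) / t
    @[t --> 0^'+] --> (0 : R).
Proof.
move=> drho rho0 rhoo sum0.
pose s i (t : R) := (rho `|Phi (X i) - f - t *: h| - rho `|Phi (X i) - f|) / t.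
have -> : (fun t => (rkde_objective H rho X (f + t *: h)
                     - rkde_objective H rho X f) / t) =
          (fun t => n%:R^-1 * \sum_(i < n) s i t).
  apply/funext => t; rewrite /rkde_objective -mulrBr -mulrA; congr (_ * _).
  rewrite -sumrB mulr_suml; apply: eq_bigr => i _.
  by rewrite /s opprD addrA.
(* The target 0 is rewritten as the average of the termwise limits, which by linearity of the inner
   product is a multiple of the pairing of the vanishing sum [sum0] with [h]. *)
rewrite [X in _ --> X](_ : 0 = n%:R^-1 * \sum_(i < n)
    - (loss_phi rho `|Phi (X i) - f| * rkhs_dot H (Phi (X i) - f) h)); last first.
  rewrite sumrN (_ : \sum_(i < n) _ = 0) ?oppr0 ?mulr0//.
  under eq_bigr do rewrite -linearZl_LR.
  by rewrite -linear_sumlz sum0 linear0l.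
apply: cvgM; first exact: cvg_cst.
apply: (cvg_big add_continuous) => i _.
exact: (loss_norm_slope _ _ _ (@rkhs_normE _ _ _ H)).
Qed.

End Objective.

Lemma convex_stationary_argmin (R : realType) (E : lmodType R) (J : E -> R) (f : E) :
  strictly_convex J ->
  (forall h, (J (f + t *: h) - J f) / t @[t --> 0^'+] --> (0 : R)) ->
  is_argmin J f.
Proof.
move=> hJ slope.
have fmin g : J f <= J g.
  have [->//|gf] := eqVneq g f.
  (* The 0 in [0 <= J g - J f] is read as the limit of the slopes towards [g], each bounded by
     [J g - J f] through convexity. *)
  rewrite -subr_ge0 -(cvg_lim _ (slope (g - f)))//.
  apply: limr_le; first by apply/cvg_ex; exists 0; exact: slope.
  near=> t.
  have t0 : 0 < t by near: t; exact: nbhs_right_gt.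
  have t1 : t < 1 by near: t; exact: nbhs_right_lt.
  have := hJ g f t gf t0 t1.
  rewrite (_ : t *: g + (1 - t) *: f = f + t *: (g - f)); last first.
    by rewrite scalerBr scalerBl scale1r addrCA addrA.
  rewrite ler_pdivrMr//; lra.
split=> // g gmin; apply/eqP/negPn/negP => gf.
(* Were there two distinct minimizers, strict convexity would put the value at their midpoint below
   the minimum. *)
have := hJ g f 2^-1 gf.
have := gmin f; have := fmin (2^-1 *: g + (1 - 2^-1) *: f).
lra.
Unshelve. all: by end_near.
Qed.

Theorem theorem2 (R : realType) (d n : nat)
    (k : 'rV[R]_d -> 'rV[R]_d -> R) (hk : smoothing_kernel k)
    (H : rkhs k) (rho : R -> R) (hrho : differentiable_nonneg rho)
    (A1 : loss_A1 rho) (A2 : loss_A2 rho)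
    (X : 'I_n -> 'rV[R]_d)
    (hJ : strictly_convex (rkde_objective H rho X))
    (f : H) (w : 'I_n -> R)
    (hf : forall x, rkhs_eval H f x = \sum_(i < n) w i * k x (X i))
    (hw1 : \sum_(i < n) w i = 1)
    (hw : exists c : R, forall i : 'I_n,
        w i = c * loss_phi rho `|rkhs_feature H (X i) - f|) :
  is_rkde H rho X f.
Proof.
have [c wE] := hw; have [drho _] := hrho; have [_ rho0 rhoo] := A1.
apply: convex_stationary_argmin => // h.
apply: objective_slope_at_stationary => //.
by apply: stationary_point hw1 wE; exact: feature_combination.
Qed.
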